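(* Let $n\geq 3$ be an integer and let $\mathbf{x}=(x_{-n},\dots,x_{-1},x_1,\dots,x_n)$ be a melody of length $2n$ without repetition (there is no entry with index $0$). Then $\mathbf{x}$ has a reflective symmetry if and only if $x_{-i}+x_i$ is constant for $i=1,\dots,n$ (i.e. takes the same value for all these $i$). When this condition is met, the axis $\ell$ of symmetry is the line defined by $y=-x+x_{-1}+x_1$, and the reflection map is given by $\mathrm{ref}_{\ell}:(x,y)\mapsto(-y+x_{-1}+x_1,\,-x+x_{-1}+x_1)$.
   Context: A melody is a finite sequence of integers. A melody is without repetition if its entries are pairwise distinct. For a melody $\mathbf{z}=(z_1,\dots,z_{m+1})$, its M-graph is the sequence of points $M(\mathbf{z})=(p_1,\dots,p_m)$ in $\mathbb{R}^2$ with $p_i=(z_i,z_{i+1})$ for $1\leq i\leq m$. For a line $\ell$ in $\mathbb{R}^2$, $\mathrm{ref}_\ell:\mathbb{R}^2\to\mathbb{R}^2$ denotes the (Euclidean) reflection whose set of fixed points is $\ell$. The melody $\mathbf{z}$ has a reflective symmetry if there exists a line $\ell$ such that $\mathrm{ref}_\ell(p_i)=p_{m+1-i}$ for all $i\in\{1,\dots,m\}$; such a line $\ell$ is called the axis of symmetry. These definitions are applied to a melody indexed as $(x_{-n},\dots,x_{-1},x_1,\dots,x_n)$ by listing its entries in the displayed order (so the points are $(x_{-n},x_{-n+1}),\dots,(x_{-2},x_{-1}),(x_{-1},x_1),(x_1,x_2),\dots,(x_{n-1},x_n)$). *)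

(* Defs.v *)
From mathcomp Require Import all_boot all_order all_algebra.
From mathcomp Require Import classical_sets reals.
From mathcomp Require Import ring lra.

Set Implicit Arguments.
Unset Strict Implicit.
Unset Printing Implicit Defensive.

Import Order.TTheory GRing.Theory Num.Theory.
Local Open Scope classical_set_scope.
Local Open Scope ring_scope.

Definition dot (R : realType) (p q : R * R) : R := p.1 * q.1 + p.2 * q.2.

(* Squared Euclidean distance; the norm that the libraries put on [R * R] is
   the sup norm, so it is not used here. *)
Definition sqdist (R : realType) (p q : R * R) : R :=
  (p.1 - q.1) ^+ 2 + (p.2 - q.2) ^+ 2.

(* The line { p | normal . p = offset }. Proportional data give the same line,
   so lines are compared through their point sets. *)
Record line (R : realType) := Line {
  normal : R * R;
  offset : R;
  normal_neq0 : normal != 0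
}.

Definition line_points (R : realType) (l : line R) : set (R * R) :=
  [set p | dot (normal l) p = offset l].

(* p - 2 ((n . p - c) / (n . n)) n; [refl_fixed], [refl_isometry] and
   [refl_unique] below say that this is the unique Euclidean isometry whose
   set of fixed points is the line. *)
Definition refl (R : realType) (l : line R) (p : R * R) : R * R :=
  let n := normal l in
  let t := 2 * (dot n p - offset l) / dot n n in
  (p.1 - t * n.1, p.2 - t * n.2).

Lemma dot_normal_neq0 (R : realType) (l : line R) :
  dot (normal l) (normal l) != 0.
Proof.
case: l => -[a b] c /= h; apply: contra h; rewrite /dot /= -!expr2.
by rewrite paddr_eq0 ?sqr_ge0 // !sqrf_eq0.
Qed.

Lemma refl_fixed (R : realType) (l : line R) :
  [set p | refl l p = p] = line_points l.
Proof.
have := dot_normal_neq0 l; have := normal_neq0 l.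
rewrite /refl /line_points; case: l => -[a b] c /= _.
rewrite /dot /= => ab0 D; apply/seteqP; split=> -[x y] /=; last first.
  by move=> ->; rewrite subrr mulr0 !mul0r !subr0.
case=> h1 h2; set t := _ / _ in h1 h2.
have ta : t * a = 0 by lra.
have tb : t * b = 0 by lra.
have : t * (a * a + b * b) = 0 by rewrite mulrDr !mulrA ta tb !mul0r addr0.
by rewrite /t divfK // => h; lra.
Qed.

Lemma refl_isometry (R : realType) (l : line R) (p q : R * R) :
  sqdist (refl l p) (refl l q) = sqdist p q.
Proof.
have := dot_normal_neq0 l.
rewrite /refl /sqdist; case: l => -[a b] c /= _.
by case: p q => [x y] [u v]; rewrite /dot /= => D; field.
Qed.

Lemma refl_unique (R : realType) (l : line R) (f : R * R -> R * R) :
  (forall p q, sqdist (f p) (f q) = sqdist p q) ->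
  [set p | f p = p] = line_points l -> f = refl l.
Proof.
move=> iso fixf; apply/boolp.funext => p.
have fixq q : dot (normal l) q = offset l -> f q = q.
  by move=> h; have : line_points l q by []; rewrite -fixf.
have [pl|pl] := eqVneq (dot (normal l) p) (offset l).
  rewrite fixq //; have : line_points l p by [].
  by rewrite -refl_fixed /= => ->.
have nfp : f p <> p.
  move=> h; have : [set p | f p = p] p by [].
  by rewrite fixf /line_points /= => e; rewrite e eqxx in pl.
have D := dot_normal_neq0 l.
move: fixq pl D nfp; rewrite /refl; case: l {fixf} => -[a b] c /= _.
rewrite /dot /=; case: p => x y /= fixq pl D nfp.
set N := a * a + b * b in D *.
pose q1 : R * R := (c * a / N, c * b / N).
pose q2 : R * R := (c * a / N - b, c * b / N + a).
have f1 : f q1 = q1 by apply: fixq; rewrite /q1 /= /N; field.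
have f2 : f q2 = q2 by apply: fixq; rewrite /q2 /= /N; field.
have := iso (x, y) q1; have := iso (x, y) q2.
rewrite f1 f2 /sqdist; case E : (f (x, y)) => [u v] /= h2 h1.
have hb : a * v - b * u = a * y - b * x.
  move: h1 h2; set s := c * a / N; set t := c * b / N => h1 h2.
  have : 2 * (a * v - b * u) = 2 * (a * y - b * x) by lra.
  by lra.
have ha : (a * u + b * v - c) ^+ 2 = (a * x + b * y - c) ^+ 2.
  have A z w : (a * z + b * w - c) ^+ 2 =
    N * ((z - c * a / N) ^+ 2 + (w - c * b / N) ^+ 2) - (a * w - b * z) ^+ 2.
    by rewrite /N; field.
  by rewrite !A h1 hb.
move/eqP: ha; rewrite eqf_sqr => /orP[] /eqP ha.
  case: nfp; rewrite E; congr pair; apply: (mulfI D); rewrite /N.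
    have -> : (a * a + b * b) * u
      = a * (a * u + b * v - c) - b * (a * v - b * u) + a * c by ring.
    by rewrite ha hb; ring.
  have -> : (a * a + b * b) * v
    = b * (a * u + b * v - c) + a * (a * v - b * u) + b * c by ring.
  by rewrite ha hb; ring.
congr pair; apply: (mulfI D).
  have -> : N * u = a * (a * u + b * v - c) - b * (a * v - b * u) + a * c.
    by rewrite /N; ring.
  by rewrite ha hb /N; field.
have -> : N * v = b * (a * u + b * v - c) + a * (a * v - b * u) + b * c.
  by rewrite /N; ring.
by rewrite ha hb /N; field.
Qed.

Definition melody := seq int.

Definition without_repetition (z : melody) : bool := uniq z.

Definition Mgraph (R : realType) (z : melody) : seq (R * R) :=
  [seq (p.1%:~R, p.2%:~R) | p <- zip z (behead z)].

(* With 0-based positions, p_i and p_{m+1-i} become positions i and m-(i+1). *)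
Definition is_axis (R : realType) (z : melody) (l : line R) : Prop :=
  forall i : nat, (i < size (Mgraph R z))%N ->
    refl l (Mgraph R z)`_i = (Mgraph R z)`_(size (Mgraph R z) - i.+1).

Definition has_reflective_symmetry (R : realType) (z : melody) : Prop :=
  exists l : line R, is_axis z l.

(* (x_{-n}, ..., x_{-1}, x_1, ..., x_n); the values of [x] at 0 and beyond
   [-n, n] are irrelevant. *)
Definition two_sided_melody (n : nat) (x : int -> int) : melody :=
  [seq x (- i%:Z) | i <- rev (iota 1 n)] ++ [seq x i%:Z | i <- iota 1 n].

(* Main.v *)
Require Import Defs.
From mathcomp Require Import all_boot all_order all_algebra.
From mathcomp Require Import classical_sets reals.
From mathcomp Require Import zify ring lra.

Import Order.TTheory GRing.Theory Num.Theory.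
Local Open Scope classical_set_scope.
Local Open Scope ring_scope.

(** Let the axis have normal (a, b). The middle point (x_{-1}, x_1) is fixed, and
    the reflection exchanges (x_k, x_{k+1}) with (x_{-k-1}, x_{-k}). If a = b, this
    exchange says exactly that x_k + x_{-k} = x_{k+1} + x_{-k-1}. If a <> b, the
    exchanges for k = 1 and k = 2, which exist since n >= 3, form a linear system
    that forces x_3 = x_{-2}, so the melody has a repetition. *)

(** Division-free form of the reflection: [p - q] is parallel to the normal, and the midpoint of [p]
    and [q] lies on the line. Both equations are linear in the points and symmetric in [p] and
    [q]. *)
Lemma reflP (R : realType) (l : line R) (p q : R * R) :
  refl l p = q <->
  (normal l).2 * (p.1 - q.1) = (normal l).1 * (p.2 - q.2) /\
  dot (normal l) p + dot (normal l) q = 2 * offset l.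
Proof.
have := dot_normal_neq0 l; rewrite /refl.
case: l => -[a b] c /= _; case: p q => [x y] [u v]; rewrite /dot /= => D.
split=> [[<- <-]|[h1 h2]]; first by split; field.
have {h2} -> : 2 * (a * x + b * y - c) = a * (x - u) + b * (y - v) by lra.
(* These multiples supply the products of degree two that the linear arithmetic below treats as
   atoms. *)
have ha := congr1 ( *%R a) h1; have hb := congr1 ( *%R b) h1.
congr pair; apply: (mulfI D); rewrite mulrBr mulrA [_ * (_ / _)]mulrC divfK //; lra.
Qed.

(** Turns a condition on the point set into one on the data of the line, which are determined only
    up to a scalar. *)
Lemma line_points_antidiagonalP (R : realType) (l : line R) (s : R) :
  line_points l = [set p | p.2 = - p.1 + s] <->
  (normal l).1 = (normal l).2 /\ offset l = (normal l).1 * s.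
Proof.
have := dot_normal_neq0 l; rewrite /line_points.
case: l => -[a b] c /= _; rewrite /dot /= => D; split=> [E|[ab ->]].
  have on_l u : a * u + b * (- u + s) = c.
    by have : [set p : R * R | p.2 = - p.1 + s] (u, - u + s); rewrite // -E.
  have c0 := on_l 0; have ab : a = b by have := on_l 1; lra.
  by split=> //; rewrite ab; lra.
rewrite {}ab in D *; have b0 : b != 0 by apply: contraNneq D => ->; rewrite mul0r addr0.
apply/seteqP; split=> -[u v] /= => [h|->]; last by ring.
by apply: (mulfI b0); lra.
Qed.

Lemma refl_antidiagonal (R : realType) (l : line R) (s : R) (p : R * R) :
  line_points l = [set p | p.2 = - p.1 + s] -> refl l p = (- p.2 + s, - p.1 + s).
Proof.
move=> /line_points_antidiagonalP[ab cE]; apply/reflP.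
by rewrite cE /dot /= ab; split; ring.
Qed.

Lemma size_two_sided n x : size (two_sided_melody n x) = (n + n)%N.
Proof. by rewrite size_cat !size_map size_rev size_iota. Qed.

Lemma nth_two_sided_neg n x k : (1 <= k <= n)%N ->
  (two_sided_melody n x)`_(n - k) = x (- k%:Z).
Proof.
move=> hk; rewrite nth_cat size_map size_rev size_iota ifT; last by lia.
rewrite (nth_map 0%N) ?size_rev ?size_iota; last by lia.
rewrite nth_rev size_iota; last by lia.
by rewrite nth_iota; last lia; congr (x (- _)); lia.
Qed.

(** No entry has index 0, hence the shift [k.-1] on this side only. *)
Lemma nth_two_sided_pos n x k : (1 <= k <= n)%N ->
  (two_sided_melody n x)`_(n + k.-1) = x k%:Z.
Proof.
move=> hk; rewrite nth_cat size_map size_rev size_iota ifF; last by lia.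
rewrite addKn (nth_map 0%N) ?size_iota; last by lia.
by rewrite nth_iota; last lia; congr (x _); lia.
Qed.

Lemma size_Mgraph (R : realType) z : size (Mgraph R z) = (size z).-1.
Proof. by rewrite size_map size_zip size_behead; lia. Qed.

Lemma nth_Mgraph (R : realType) z i : (i.+1 < size z)%N ->
  (Mgraph R z)`_i = ((z`_i)%:~R, (z`_i.+1)%:~R).
Proof.
move=> hi.
have hz : (i < size (zip z (behead z)))%N.
  by rewrite size_zip size_behead leq_min; lia.
rewrite (nth_map (0, 0)) // nth_zip_cond hz.
by rewrite nth_behead.
Qed.

(** Position [n.-1] is its own mirror image, and [n + k.-1] is paired with [n - k.+1]. One condition
    per pair suffices, a reflection being an involution. *)
Lemma is_axis_two_sidedP (R : realType) n x (l : line R) : (0 < n)%N ->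
  is_axis (two_sided_melody n x) l <->
  refl l ((x (-1))%:~R, (x 1)%:~R) = ((x (-1))%:~R, (x 1)%:~R) /\
  forall k : nat, (1 <= k < n)%N ->
    refl l ((x k%:Z)%:~R, (x k.+1%:Z)%:~R) =
    ((x (- k.+1%:Z))%:~R, (x (- k%:Z))%:~R).
Proof.
move=> n0; set M := Mgraph R (two_sided_melody n x).
have szM : size M = (n + n).-1 by rewrite size_Mgraph size_two_sided.
have M0 : M`_n.-1 = ((x (-1))%:~R, (x 1)%:~R).
  rewrite nth_Mgraph ?size_two_sided; last by lia.
  have -> : n.-1.+1 = (n + 1.-1)%N by lia.
  have -> : n.-1 = (n - 1)%N by lia.
  by rewrite nth_two_sided_pos ?nth_two_sided_neg //; lia.
have Mpos k : (1 <= k < n)%N ->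
    M`_(n + k.-1) = ((x k%:Z)%:~R, (x k.+1%:Z)%:~R).
  move=> hk; rewrite nth_Mgraph ?size_two_sided; last by lia.
  have -> : (n + k.-1).+1 = (n + k.+1.-1)%N by lia.
  by rewrite !nth_two_sided_pos //; lia.
have Mneg k : (1 <= k < n)%N ->
    M`_(n - k.+1) = ((x (- k.+1%:Z))%:~R, (x (- k%:Z))%:~R).
  move=> hk; rewrite nth_Mgraph ?size_two_sided; last by lia.
  have -> : (n - k.+1).+1 = (n - k)%N by lia.
  by rewrite !nth_two_sided_neg //; lia.
rewrite /is_axis -/M szM; split=> [ax|[ax0 ax] i hi].
  split=> [|k hk].
    have := ax n.-1; rewrite (_ : _ - _ = n.-1)%N; last by lia.
    by rewrite M0; apply; lia.
  rewrite -Mpos // -Mneg // ax; last by lia.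
  by congr (M`_ _); lia.
have [lt_in|lt_ni|->] := ltngtP i n.-1.
- have hk : (1 <= n.-1 - i < n)%N by lia.
  have -> : i = (n - (n.-1 - i).+1)%N by lia.
  rewrite [in RHS](_ : _ - _ = n + (n.-1 - i).-1)%N; last by lia.
  (* The reversed exchange follows from the symmetry of [reflP] in its two points. *)
  rewrite Mneg // Mpos //; apply/reflP; have /reflP[h1 h2] := ax _ hk.
  by split; [move: h1 => /=; lra | rewrite addrC].
- have hk : (1 <= i - n.-1 < n)%N by lia.
  have -> : i = (n + (i - n.-1).-1)%N by lia.
  rewrite [in RHS](_ : _ - _ = n - (i - n.-1).+1)%N; last by lia.
  by rewrite Mneg // Mpos // ax.
- by rewrite (_ : _ - _ = n.-1)%N ?M0 //; lia.
Qed.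

(* The indices of X and Y are those of x_k and x_{-k}. *)
Lemma normal_diagonal (R : realType) (l : line R) (X1 X2 X3 Y1 Y2 Y3 : R) :
  refl l (Y1, X1) = (Y1, X1) -> refl l (X1, X2) = (Y2, Y1) ->
  refl l (X2, X3) = (Y3, Y2) -> X1 != Y1 -> X3 != Y2 ->
  (normal l).1 = (normal l).2.
Proof.
move=> /reflP[_ +] /reflP[+ +] /reflP[+ +] h1 h3.
case: l => -[a b] c /= _; rewrite /dot /= => e0 e1 e2 e3 e4.
apply/eqP/negPn/negP => ab.
have abN0 : b - a != 0 by rewrite subr_eq0 eq_sym.
(* [X2E] comes from adding [e1] to [e2 - e0], and [sumE] from subtracting it. *)
have X2E : X2 - Y2 = X1 - Y1 by apply: (mulfI abN0); lra.
have sumE : (a + b) * (X2 + Y2 - X1 - Y1) = 2 * ((b - a) * (X1 - Y1)) by lra.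
have abD0 : a + b != 0.
  apply/eqP => ab0; move/eqP: sumE; rewrite ab0 mul0r eq_sym !mulf_eq0.
  by rewrite pnatr_eq0 (negPf abN0) subr_eq0 (negPf h1).
case/eqP: h3; apply: (mulfI abN0); apply: (mulfI abD0).
have {}X2E : X2 = Y2 + X1 - Y1 by lra.
have cE : c = a * Y1 + b * X1 by lra.
subst X2 c.
(* The sum of [e3'] and [e4'] eliminates [Y3]; [sumE'] then eliminates the rest. *)
have e3' := congr1 ( *%R a) e3; have e4' := congr1 ( *%R b) e4.
have sumE' := congr1 ( *%R b) sumE.
lra.
Qed.

(** The axis is found before the sums are known to be constant: the exchanges give its direction,
    the fixed middle point its offset. *)
Lemma axis_two_sided (R : realType) n x (l : line R) : (3 <= n)%N ->
  uniq (two_sided_melody n x) -> is_axis (two_sided_melody n x) l ->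
  line_points l = [set p | p.2 = - p.1 + (x (-1) + x 1)%:~R].
Proof.
move=> hn hx /is_axis_two_sidedP[|ax0 ax]; first by lia.
have pos_neq_neg i j : (1 <= i <= n)%N -> (1 <= j <= n)%N ->
    (x i%:Z)%:~R != (x (- j%:Z))%:~R :> R.
  move=> hi hj; rewrite eqr_int -(nth_two_sided_pos n x i) //.
  rewrite -(nth_two_sided_neg n x j) // nth_uniq ?size_two_sided //; lia.
have ab : (normal l).1 = (normal l).2.
  by apply: (normal_diagonal _ _ _ _ _ _ _ _ ax0 (ax 1%N _) (ax 2%N _));
     rewrite ?pos_neq_neg //; lia.
apply/line_points_antidiagonalP; split=> //.
have /reflP[_] := ax0; rewrite /dot /= -ab intrD; lra.
Qed.

(** This reflection swaps the coordinates and replaces each entry [x_i] by [c - x_i], which is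
    [x_{-i}]. *)
Lemma constant_sums_axis (R : realType) n x (c : int) (l : line R) : (0 < n)%N ->
  (forall i : nat, (1 <= i <= n)%N -> x (- i%:Z) + x i%:Z = c) ->
  line_points l = [set p | p.2 = - p.1 + c%:~R] ->
  is_axis (two_sided_melody n x) l.
Proof.
move=> n0 xc /refl_antidiagonal lE; apply/is_axis_two_sidedP => //.
have xE i : (1 <= i <= n)%N -> (x (- i%:Z))%:~R = - (x i%:Z)%:~R + c%:~R :> R.
  by move=> hi; rewrite -(xc i hi) intrD; ring.
split=> [|k hk]; rewrite lE /=.
  by rewrite (xE 1%N); [congr pair; ring | lia].
by rewrite !xE //; lia.
Qed.

Theorem theorem2p1 (R : realType) (n : nat) (x : int -> int)
    (hn : (3 <= n)%N)
    (hx : without_repetition (two_sided_melody n x)) :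
  let s : R := (x (-1) + x 1)%:~R in
  let constant_sums :=
    exists c : int, forall i : nat, (1 <= i <= n)%N -> x (- i%:Z) + x i%:Z = c in
  (has_reflective_symmetry R (two_sided_melody n x) <-> constant_sums) /\
  (constant_sums ->
     (forall l : line R, is_axis (two_sided_melody n x) l <->
        line_points l = [set p : R * R | p.2 = - p.1 + s]) /\
     (forall l : line R, is_axis (two_sided_melody n x) l ->
        forall p : R * R, refl l p = (- p.2 + s, - p.1 + s))).
Proof.
move=> s constant_sums; have n0 : (0 < n)%N by lia.
have axisE (l : line R) : is_axis (two_sided_melody n x) l ->
    line_points l = [set p | p.2 = - p.1 + s] by exact: axis_two_sided.
have axisI (l : line R) : constant_sums ->
    line_points l = [set p | p.2 = - p.1 + s] -> is_axis (two_sided_melody n x) l.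
  case=> c xc; rewrite /s (xc 1%N n0); exact: constant_sums_axis.
split; last first.
  move=> cs; split=> [l|l /axisE lE p]; last exact: refl_antidiagonal.
  by split=> [/axisE|/(axisI _ cs)].
split=> [[l lax]|cs].
  exists (x (-1) + x 1) => i hi; have /is_axis_two_sidedP[//|_ ax] := lax.
  elim: i hi => // -[//|k] IH hk.
  (* For the index [k.+2], the first coordinate of the image of [(x_{k+1}, x_{k+2})] gives
     [s - x_{k+2} = x_{-k-2}]. *)
  have := ax k.+1 hk; rewrite (refl_antidiagonal _ _ _ _ (axisE _ lax)).
  case=> /eqP + _; rewrite /= addrC -rmorphB eqr_int => /eqP sumE.
  by have := IH (ltnW hk); lia.
(* The witness is the line with normal [(1, 1)] and offset [s]. *)
have normal0 : (1, 1) != 0 :> R * R by rewrite xpair_eqE oner_eq0.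
exists (Line s normal0); apply: axisI => //.
by apply/line_points_antidiagonalP; rewrite mul1r.
Qed.
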